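(* For every positive integer $n$, $$\sum_{r=0}^\infty(-1)^{T_r}\,a(n-T_r)=\begin{cases}(-1)^{T_{k-1}}\,T_{\lceil k/2\rceil}, & \text{if } n=T_{k+1}\text{ for some integer }k\ge1,\\ 0,&\text{otherwise.}\end{cases}$$
   Context: For a positive integer $n$, $a(n)$ is the signed number of partitions of $n$ into exactly two distinct part sizes, each occurring an odd number of times: $$a(n)=\sum (-1)^{r_1+r_2},$$ the sum being over all quadruples of integers $(x,y,r_1,r_2)$ with $1\le x<y$, $r_1,r_2\ge 0$ and $(2r_1+1)x+(2r_2+1)y=n$. By convention $a(m)=0$ for $m\le0$, so the sum in the claim is finite. $T_n=n(n+1)/2$ denotes the $n$-th triangular number. *)

(* Defs.v *)
From HB Require Import structures.
From mathcomp Require Import all_boot all_order all_algebra.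
From mathcomp Require Import boolp classical_sets functions cardinality fsbigop.
From mathcomp Require Import zify.

Set Implicit Arguments.
Unset Strict Implicit.
Unset Printing Implicit Defensive.

Import Order.TTheory GRing.Theory Num.Theory.
Local Open Scope classical_set_scope.
Local Open Scope ring_scope.

Definition T (n : nat) : nat := ((n * n.+1) %/ 2)%N.

(* The bounds x, y, r1, r2 <= n lose no quadruple: see [quadruple_bound]. *)
Definition a (m : int) : int :=
  if m is Posz n then
    \sum_(x < n.+1) \sum_(y < n.+1) \sum_(r1 < n.+1)
      \sum_(r2 < n.+1 | [&& (1 <= x)%N, (x < y)%N &
              ((2 * r1 + 1) * x + (2 * r2 + 1) * y == n)%N])
        (-1) ^+ (r1 + r2)%N
  else 0.

Lemma quadruple_bound (n x y r1 r2 : nat) :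
  (1 <= x)%N -> (x < y)%N -> ((2 * r1 + 1) * x + (2 * r2 + 1) * y = n)%N ->
  [/\ (x < n.+1)%N, (y < n.+1)%N, (r1 < n.+1)%N & (r2 < n.+1)%N].
Proof. by move=> x1 xy E; split; nia. Qed.

Lemma a_le0 (m : int) : m <= 0 -> a m = 0.
Proof.
case: m => [[|n]|n] //= _.
by rewrite !big_ord1; apply: big1 => -[[|r] lt_r].
Qed.

Lemma leq_T (r : nat) : (r <= T r)%N.
Proof. by rewrite /T leq_divRL //; case: r => // r; rewrite leq_mul. Qed.

(* [\sum_(r \in setT)] is 0 by convention on infinite supports; this shows
   that the sum over all r is a genuine finite sum. *)
Lemma finite_supp_summand (n : nat) :
  finite_set [set r : nat | (-1) ^+ T r * a (n%:Z - (T r)%:Z) != 0].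
Proof.
apply: (sub_finite_set _ (finite_II n.+1)) => r /=; apply: contraNT.
rewrite -leqNgt => lt_nr; rewrite a_le0 ?mulr0 //.
by rewrite subr_le0 lez_nat (leq_trans (ltnW lt_nr)) ?leq_T.
Qed.

(* Main.v *)
(* With [z_x = q^x / (1 + q^(2x))], the generating function of [a] is the
   second elementary symmetric function of the [z_x], that is, the coefficient
   of [t^2] in [prod_x (1 + t q^x + q^(2x)) / prod_x (1 + q^(2x))].  By Jacobi's
   triple product with [t = zeta + 1/zeta],
     [prod_x (1 - q^x) (1 + t q^x + q^(2x)) = sum_n c_n(t) q^(T n)]
   where [c_0 = 1], [c_1 = t - 1] and [c_(n+2) = t c_(n+1) - c_n].  At [t = 0]
   the right-hand side is [sum_r (-1)^(T r) q^(T r)]; comparing the coefficients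
   of [t^2] gives the result.  Power series are handled as polynomials in [q]
   modulo [q^(N+1)], and the triple product through its finite form. *)

Require Import Defs.
From mathcomp Require Import all_boot all_order all_algebra.
From mathcomp Require Import boolp classical_sets functions cardinality fsbigop.
From mathcomp Require Import zify ring.

Set Implicit Arguments.
Unset Strict Implicit.
Unset Printing Implicit Defensive.

Import Order.TTheory GRing.Theory Num.Theory.
Local Open Scope classical_set_scope.
Local Open Scope ring_scope.

Lemma T0 : T 0 = 0%N. Proof. by []. Qed.

Lemma TS n : T n.+1 = (T n + n.+1)%N.
Proof. by rewrite /T; lia. Qed.

(** * Finite form of the triple product *)

Section TripleProduct.
Variables (R : comNzRingType) (q t : R).

(* [cheb n = (zeta^n + zeta^(-n-1)) / (1 + zeta^(-1))] for [t = zeta + 1/zeta]. *)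
Fixpoint cheb n : R :=
  match n with
  | 0 => 1
  | m.+1 => if m is p.+1 then t * cheb m - cheb p else t - 1
  end.

Lemma chebSS n : cheb n.+2 = t * cheb n.+1 - cheb n.
Proof. by []. Qed.

(** For [j <= M] this is [(q;q)_M / (q;q)_(M-j)] without division. For [j > M] the factor [k = M] is
    [1 - q^0 = 0]. *)
Definition qfall M j : R := \prod_(k < j) (1 - q ^+ (M - k)).

Lemma qfall0 M : qfall M 0 = 1.
Proof. by rewrite /qfall big_ord0. Qed.

Lemma qfallSr M j : qfall M j.+1 = qfall M j * (1 - q ^+ (M - j)).
Proof. by rewrite /qfall big_ord_recr. Qed.

Lemma qfallSS M j : qfall M.+1 j.+1 = (1 - q ^+ M.+1) * qfall M j.
Proof. by rewrite /qfall big_ord_recl subn0. Qed.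

Lemma qfall_gt M j : (M < j)%N -> qfall M j = 0.
Proof.
elim: j => // j IH; rewrite ltnS leq_eqVlt qfallSr => /orP[/eqP->|/IH->].
  by rewrite subnn subrr mulr0.
by rewrite mul0r.
Qed.

(* [q ^+ T n] times [\prod_(i < N) (1 - q ^+ i.+1)] times the q-binomial coefficient
   [2N+1 choose N-n], written without division. *)
Definition jweight N n : R :=
  q ^+ T n * (qfall N n * qfall N.*2.+1 (N - n)).

Lemma jweight_gt N n : (N < n)%N -> jweight N n = 0.
Proof. by move=> Nn; rewrite /jweight qfall_gt // mul0r mulr0. Qed.

(* The shape of the case [n = 0] of [jweightSS] reflects [c_(-1) = c_0]. *)
Lemma jweightS0 N :
  jweight N.+1 0 = (1 - q ^+ N.+1) *
    ((1 + q ^+ N.+1 ^+ 2) * jweight N 0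
     + q ^+ N.+1 * (jweight N 0 + jweight N 1)).
Proof.
case: N => [|N].
  by rewrite (@jweight_gt 0 1) // /jweight !subn0 !qfallSr !qfall0 /=; ring.
rewrite /jweight !subn0 !T0 TS T0 add0n !qfall0 subSS subn0.
rewrite [in LHS]doubleS ![in LHS]qfallSS !qfallSr !qfall0 !subn0.
rewrite (_ : N.+1.*2.+1 - N = N.+3)%N; last lia.
rewrite (_ : N.+1.*2.+2 = N + N + 4)%N; last lia.
rewrite (_ : N.+1.*2.+1 = N + N + 3)%N; last lia.
rewrite !exprS !exprD; ring.
Qed.

(** Two q-Pascal steps take row [2N+1] to row [2N+3]. The right side is what the new factor
    [(1 - Q)(1 + Q^2 + tQ)], with [Q = q^(N+1)], contributes at [cheb n.+1]. *)
Lemma jweightSS N n : (n <= N)%N ->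
  jweight N.+1 n.+1 = (1 - q ^+ N.+1) *
    ((1 + q ^+ N.+1 ^+ 2) * jweight N n.+1
     + q ^+ N.+1 * (jweight N n + jweight N n.+2)).
Proof.
move=> nN; have [e ->] : exists e, N = (n + e)%N by exists (N - n)%N; lia.
(* For [N - n < 2] a weight on the right lies beyond the end of the row and is zero; truncated
   subtraction would hide this in the generic computation. *)
move: e => [|[|e]].
- rewrite addn0 (@jweight_gt n n.+1) // (@jweight_gt n n.+2) //.
  by rewrite /jweight !subnn !qfall0 qfallSS TS exprD; ring.
- rewrite (@jweight_gt (n + 1) n.+2); last lia.
  rewrite /jweight !TS qfallSS (_ : n + 1 - n.+1 = 0)%N; last lia.
  rewrite (_ : (n + 1).+1 - n.+1 = 1)%N; last lia.
  rewrite (_ : n + 1 - n = 1)%N; last lia.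
  rewrite !qfallSr !qfall0 !subn0 (_ : n + 1 - n = 1)%N; last lia.
  rewrite (_ : (n + 1).+1.*2.+1 = n + n + 5)%N; last lia.
  rewrite (_ : (n + 1).*2.+1 = n + n + 3)%N; last lia.
  rewrite !exprD !exprS !exprD; ring.
rewrite /jweight !TS qfallSS (_ : n + e.+2 - n.+1 = e.+1)%N; last lia.
rewrite (_ : (n + e.+2).+1 - n.+1 = e.+2)%N; last lia.
rewrite (_ : n + e.+2 - n = e.+2)%N; last lia.
rewrite (_ : n + e.+2 - n.+2 = e)%N; last lia.
rewrite [in LHS]doubleS ![in LHS]qfallSS !qfallSr.
rewrite (_ : n + e.+2 - n.+1 = e.+1)%N; last lia.
rewrite (_ : n + e.+2 - n = e.+2)%N; last lia.
rewrite (_ : (n + e.+2).*2.+1 - e = n + n + e + 5)%N; last lia.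
rewrite (_ : (n + e.+2).*2.+1 - e.+1 = n + n + e + 4)%N; last lia.
rewrite -!/((n + e.+2).*2.+1).
(* Once [F] and [qfall (n + e.+2) n] are common factors, what remains is an identity between powers
   of [q]. *)
set F := qfall (n + e.+2).*2.+1 e.
rewrite (_ : (n + e.+2).*2.+3 = n + n + e + e + 7)%N; last lia.
rewrite (_ : (n + e.+2).*2.+2 = n + n + e + e + 6)%N; last lia.
rewrite !exprD !exprS !exprD !exprS; ring.
Qed.

(** Summation by parts: [t c_(n+1) = c_(n+2) + c_n] and [t c_0 = c_1 + c_0] move the factor [t] onto
    the weights. The subtracted term is the boundary, which vanishes for [jweight N]. *)
Lemma cheb_sum N (w : nat -> R) :
  t * (\sum_(n < N.+1) cheb n * w n) =
    w 0 + w 1 + \sum_(n < N.+1) cheb n.+1 * (w n + w n.+2)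
    - (cheb N * w N.+1 + cheb N.+1 * w N.+2).
Proof.
elim: N => [|N IH]; first by rewrite !big_ord1 /=; ring.
by rewrite big_ord_recr [X in _ + X - _]big_ord_recr mulrDr IH chebSS /=; ring.
Qed.

Lemma finite_triple_product N :
  \prod_(i < N) ((1 - q ^+ i.+1) * (1 + q ^+ i.+1 ^+ 2 + t * q ^+ i.+1)) =
  \sum_(n < N.+1) cheb n * jweight N n.
Proof.
elim: N => [|N IH].
  by rewrite big_ord0 big_ord1 /jweight !qfall0 /= expr0 !mulr1.
rewrite big_ord_recr /= {}IH.
set S := \sum_(n < N.+1) _.
(* Adding the zero term at [N.+1] before splitting off [cheb 0] gives the same index range as in
   [htS]. *)
have hS : S = jweight N 0 + \sum_(n < N.+1) cheb n.+1 * jweight N n.+1.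
  transitivity (\sum_(n < N.+2) cheb n * jweight N n).
    by rewrite big_ord_recr /= jweight_gt // mulr0 addr0.
  by rewrite big_ord_recl mul1r.
have htS := cheb_sum N (jweight N).
rewrite -/S !(@jweight_gt N N.+1) ?(@jweight_gt N N.+2) // !mulr0 addr0 subr0
  in htS.
set Q := q ^+ N.+1.
transitivity ((1 - Q) * ((1 + Q ^+ 2) * S + Q * (t * S))); first by ring.
rewrite htS hS [in RHS]big_ord_recl /= mul1r jweightS0 -/Q.
have -> : \sum_(i < N.+1) cheb (bump 0 i) * jweight N.+1 (bump 0 i) =
    (1 - Q) * ((1 + Q ^+ 2) * (\sum_(n < N.+1) cheb n.+1 * jweight N n.+1)
      + Q * \sum_(n < N.+1) cheb n.+1 * (jweight N n + jweight N n.+2)).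
  rewrite !mulr_sumr -big_split mulr_sumr; apply: eq_bigr => i _.
  rewrite /bump leq0n add1n (jweightSS (ltn_ord i : (i <= N)%N)) -/Q.
  by move: (cheb i.+1) (jweight N i) (jweight N i.+1) => x y z /=; ring.
by move: (\sum_(n < _) _) (\sum_(n < _) _) => x y; ring.
Qed.

(** * Congruences modulo powers of [q], over any ring so as to serve for polynomials in [q] and in
    [t] over [q] *)

Definition cong (e : nat) (x y : R) := exists u, x = y + q ^+ e * u.

Lemma cong_refl e x : cong e x x.
Proof. by exists 0; rewrite mulr0 addr0. Qed.

Lemma cong_sym e x y : cong e x y -> cong e y x.
Proof. by case=> u ->; exists (- u); ring. Qed.

Lemma cong_trans e x y z : cong e x y -> cong e y z -> cong e x z.
Proof. by move=> [u ->] [v ->]; exists (u + v); ring. Qed.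

Lemma congD e x y x' y' :
  cong e x y -> cong e x' y' -> cong e (x + x') (y + y').
Proof. by move=> [u ->] [v ->]; exists (u + v); ring. Qed.

Lemma congM e x y x' y' :
  cong e x y -> cong e x' y' -> cong e (x * x') (y * y').
Proof.
by move=> [u ->] [v ->]; exists (u * y' + y * v + u * q ^+ e * v); ring.
Qed.

Lemma cong_sum e (I : Type) (r : seq I) (P : pred I) (F G : I -> R) :
  (forall i, P i -> cong e (F i) (G i)) ->
  cong e (\sum_(i <- r | P i) F i) (\sum_(i <- r | P i) G i).
Proof.
move=> h; elim/big_ind2: _ => //;
  by [exact: cong_refl | move=> *; exact: congD].
Qed.

Lemma cong_prod e (I : Type) (r : seq I) (P : pred I) (F G : I -> R) :
  (forall i, P i -> cong e (F i) (G i)) ->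
  cong e (\prod_(i <- r | P i) F i) (\prod_(i <- r | P i) G i).
Proof.
move=> h; elim/big_ind2: _ => //;
  by [exact: cong_refl | move=> *; exact: congM].
Qed.

Lemma cong_le e e' x y : (e <= e')%N -> cong e' x y -> cong e x y.
Proof.
by move=> le [u ->]; exists (q ^+ (e' - e) * u); rewrite mulrA -exprD subnKC.
Qed.

Lemma cong_expM e d x y : cong e x y -> cong (d + e) (q ^+ d * x) (q ^+ d * y).
Proof. by case=> u ->; exists u; rewrite exprD; ring. Qed.

Lemma cong_qfall M j e : (e + j <= M.+1)%N -> cong e (qfall M j) 1.
Proof.
move=> h; apply: (@cong_trans _ _ (\prod_(k < j) 1)); last first.
  by rewrite big1_eq; exact: cong_refl.
apply: cong_prod => i _; apply: (@cong_le _ (M - i)).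
  by have := ltn_ord i; lia.
by exists (-1); rewrite mulrN1.
Qed.

Lemma cong_jweight N n : (n <= N)%N -> cong N.+1 (jweight N n) (q ^+ T n).
Proof.
move=> nN; rewrite -[X in cong _ _ X]mulr1 -[X in _ * X]mulr1.
(* Both [qfall] factors are 1 modulo [q^(N-n+1)]; the prefactor [q^(T n)] makes up the missing [n]
   because [n <= T n]. *)
apply: (@cong_le _ (T n + (N - n).+1)); first by have := leq_T n; lia.
by apply: cong_expM; apply: congM; apply: cong_qfall; lia.
Qed.

Lemma triple_product_mod N :
  cong N.+1
    (\prod_(i < N) ((1 - q ^+ i.+1) * (1 + q ^+ i.+1 ^+ 2 + t * q ^+ i.+1)))
    (\sum_(n < N.+1) cheb n * q ^+ T n).
Proof.
rewrite finite_triple_product; apply: cong_sum => i _.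
by apply: congM; [exact: cong_refl | apply: cong_jweight; rewrite -ltnS].
Qed.

(* Truncation of the expansion of [q^x / (1 + q^(2x))]. *)
Definition zsum N (x : nat) : R :=
  \sum_(r < N.+1) (-1) ^+ r * q ^+ ((2 * r + 1) * x).

Lemma zsum_mod N x : (0 < x)%N ->
  cong N.+1 ((1 + q ^+ x ^+ 2) * zsum N x) (q ^+ x).
Proof.
move=> x0; apply: (@cong_le _ ((2 * N.+1 + 1) * x)); first by nia.
exists ((-1) ^+ N); rewrite /zsum; elim: N => [|N IH].
  rewrite big_ord1 expr0 mul1r mulr1 !muln1 muln0 add0n mul1n.
  rewrite (_ : (2 + 1) * x = x + x + x)%N; last lia.
  rewrite !exprD; ring.
rewrite big_ord_recr mulrDr {}IH /=.
rewrite (_ : (2 * N.+2 + 1) * x = (2 * N.+1 + 1) * x + x + x)%N; last lia.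
rewrite [(-1) ^+ N.+1]exprS !(exprD _ _ x); ring.
Qed.

End TripleProduct.

(** * Low coefficients of [cheb] as a polynomial in [t] *)

Lemma signr_TSS (R : pzRingType) n : (-1) ^+ T n.+2 = - (-1) ^+ T n :> R.
Proof.
(* The exponents [T n.+2] and [T n] differ by the odd number [2n+3]. *)
rewrite -[RHS]mulN1r -exprS -[LHS]signr_odd -[RHS]signr_odd; congr (_ ^+ _).
by rewrite !TS; lia.
Qed.

Lemma nat_ind2 (P : nat -> Prop) :
  P 0 -> P 1 -> (forall n, P n -> P n.+2) -> forall n, P n.
Proof.
move=> P0 P1 PSS n; suff: P n /\ P n.+1 by case.
by elim: n => // n [Pn PSn]; split=> //; exact: PSS.
Qed.

Lemma cheb_at0 (R : comNzRingType) n : cheb (0 : R) n = (-1) ^+ T n.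
Proof.
elim/nat_ind2: n => [||n IH]; first by [].
  by rewrite /cheb sub0r /T expr1.
by rewrite chebSS mul0r sub0r IH signr_TSS.
Qed.

Section ChebCoefficients.
Variable S : comNzRingType.
Let c n : {poly S} := cheb 'X n.

Lemma coef_chebSS n i : (c n.+2)`_i.+1 = (c n.+1)`_i - (c n)`_i.+1.
Proof. by rewrite /c chebSS coefB coefXM. Qed.

Lemma coef0_cheb n : (c n)`_0 = (-1) ^+ T n.
Proof.
elim/nat_ind2: n => [||n IH]; first by rewrite /c coef1.
  by rewrite /c coefB coefX coef1 sub0r /T expr1.
by rewrite /c chebSS coefB coefXM sub0r IH signr_TSS.
Qed.

Lemma coef1_cheb n : (c n.+1)`_1 = (-1) ^+ T n * (uphalf n.+1)%:R.
Proof.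
elim/nat_ind2: n => [||n IH].
- by rewrite /c coefB coefX coef1 /= subr0 mulr1.
- by rewrite coef_chebSS coef0_cheb /c coef1 subr0 mulr1.
- rewrite coef_chebSS coef0_cheb IH signr_TSS.
  have -> : uphalf n.+3 = (uphalf n.+1).+1 by [].
  by move: (uphalf n.+1) => u; rewrite mulrS; ring.
Qed.

(** Up to sign, each double step adds the linear coefficient [uphalf n.+3], so the values accumulate
    as [1 + 2 + 3 + ...], giving triangular numbers. *)
Lemma coef2_cheb n : (c n.+2)`_2 = (-1) ^+ T n * (T (uphalf n.+1))%:R.
Proof.
elim/nat_ind2: n => [||n IH].
- by rewrite coef_chebSS coef1_cheb /c coef1 subr0.
- by rewrite coef_chebSS coef1_cheb /c coefB coefX coef1 !subr0.
- rewrite coef_chebSS coef1_cheb IH signr_TSS.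
  have -> : uphalf n.+3 = (uphalf n.+1).+1 by [].
  by move: (uphalf n.+1) => u; rewrite TS natrD; ring.
Qed.

Lemma coef2_cheb_lt2 n : (n < 2)%N -> (c n)`_2 = 0.
Proof.
by case: n => [|[|]] // _; rewrite /c ?coefB ?coefX ?coef1 /= ?subr0.
Qed.

End ChebCoefficients.

(** * Second elementary symmetric function as a coefficient of a product of linear factors *)

Section SecondSymmetric.
Variables (S : comNzRingType) (z : nat -> S).
Let p N := \prod_(i < N) (1 + 'X * (z i)%:P).

Lemma coef_prod_linear N i :
  (p N.+1)`_i.+1 = (p N)`_i.+1 + (p N)`_i * z N.
Proof.
by rewrite /p big_ord_recr /= mulrDr mulr1 coefD mulrCA coefXM coefMC.
Qed.

Lemma coef0_prod_linear N : (p N)`_0 = 1.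
Proof.
elim: N => [|N IH]; first by rewrite /p big_ord0 coef1.
by rewrite /p big_ord_recr /= mulrDr mulr1 coefD IH mulrCA coefXM addr0.
Qed.

Lemma coef1_prod_linear N : (p N)`_1 = \sum_(x < N) z x.
Proof.
elim: N => [|N IH]; first by rewrite /p !big_ord0 coef1.
by rewrite coef_prod_linear IH coef0_prod_linear mul1r big_ord_recr.
Qed.

Lemma coef2_prod_linear N : (p N)`_2 = \sum_(y < N) \sum_(x < y) z x * z y.
Proof.
elim: N => [|N IH]; first by rewrite /p !big_ord0 coef1.
by rewrite coef_prod_linear IH coef1_prod_linear big_ord_recr /= mulr_suml.
Qed.

End SecondSymmetric.

(** * The values of [a] as coefficients in [q] *)

Lemma big_ord_trunc (V : nmodType) (F : nat -> V) m N : (m <= N)%N ->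
  (forall i, (m < i)%N -> F i = 0) ->
  \sum_(i < m.+1) F i = \sum_(i < N.+1) F i.
Proof.
move=> mN F0; rewrite (big_ord_widen _ F (mN : (m < N.+1)%N)) big_mkcond /=.
by apply: eq_bigr => i _; rewrite ltnS; case: leqP => // /F0.
Qed.

(** The ranges in [a] change with [m]; one common bound [N] lets all values with [m <= N] be read
    off a single polynomial. The added terms vanish by [quadruple_bound]. *)
Lemma a_widen N m : (m <= N)%N -> a m%:Z =
  \sum_(x < N.+1) \sum_(y < N.+1)
    if (1 <= x)%N && (x < y)%N then
      \sum_(r1 < N.+1) \sum_(r2 < N.+1)
        (-1) ^+ r1 * (-1) ^+ r2 *
        ((m == (2 * r1 + 1) * x + (2 * r2 + 1) * y)%N)%:R
    else 0.
Proof.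
move=> mN.
pose f (x y r1 r2 : nat) : int :=
  if [&& (1 <= x)%N, (x < y)%N & ((2 * r1 + 1) * x + (2 * r2 + 1) * y == m)%N]
  then (-1) ^+ (r1 + r2) else 0.
have f0 x y r1 r2 :
    ~~ [&& (x < m.+1)%N, (y < m.+1)%N, (r1 < m.+1)%N & (r2 < m.+1)%N] ->
    f x y r1 r2 = 0.
  rewrite /f; case: ifP => // /and3P[x1 xy /eqP E] /negP[].
  by have [-> -> -> ->] := quadruple_bound x1 xy E.
transitivity (\sum_(x < N.+1) \sum_(y < N.+1) \sum_(r1 < N.+1)
    \sum_(r2 < N.+1) f x y r1 r2).
  rewrite /a -(big_ord_trunc (F := fun x => \sum_(y < N.+1) \sum_(r1 < N.+1)
    \sum_(r2 < N.+1) f x y r1 r2) mN); last first.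
    move=> i mi; do 3!apply: big1 => ? _; apply: f0.
    by lia.
  apply: eq_bigr => x _.
  rewrite -(big_ord_trunc (F := fun y => \sum_(r1 < N.+1)
    \sum_(r2 < N.+1) f x y r1 r2) mN); last first.
    move=> i mi; do 2!apply: big1 => ? _; apply: f0.
    by lia.
  apply: eq_bigr => y _.
  rewrite -(big_ord_trunc (F := fun r1 => \sum_(r2 < N.+1) f x y r1 r2) mN);
    last first.
    move=> i mi; apply: big1 => ? _; apply: f0.
    by lia.
  apply: eq_bigr => r1 _.
  rewrite -(big_ord_trunc (F := fun r2 => f x y r1 r2) mN); last first.
    move=> i mi; apply: f0.
    by lia.
  by rewrite big_mkcond.
apply: eq_bigr => x _; apply: eq_bigr => y _; rewrite /f.
case: (1 <= x)%N => /=; last by apply: big1 => ? _; apply: big1.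
case: (x < y)%N => /=; last by apply: big1 => ? _; apply: big1.
apply: eq_bigr => r1 _; apply: eq_bigr => r2 _.
by rewrite eq_sym exprD; case: eqP => _; rewrite ?mulr1 ?mulr0.
Qed.

Lemma coef_zsumM N m x y :
  (zsum 'X N x * zsum 'X N y : {poly int})`_m =
  \sum_(r1 < N.+1) \sum_(r2 < N.+1) (-1) ^+ r1 * (-1) ^+ r2 *
        ((m == (2 * r1 + 1) * x + (2 * r2 + 1) * y)%N)%:R.
Proof.
rewrite /zsum mulr_suml coef_sum; apply: eq_bigr => r1 _.
rewrite mulr_sumr coef_sum; apply: eq_bigr => r2 _.
rewrite mulrACA -exprD -coefXn -coefCM.
by rewrite polyC_exp polyCN polyC1 !exprD.
Qed.

Lemma coef_zsum_a N m : (m <= N)%N ->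
  (\sum_(y < N) \sum_(x < y) zsum 'X N x.+1 * zsum 'X N y.+1 : {poly int})`_m
  = a m%:Z.
Proof.
(* The terms with [x = 0] or [y = 0] are zero; removing them yields the shifted parts [x.+1] and
   [y.+1]. *)
move=> mN; rewrite (a_widen mN) [RHS]big_ord_recl.
rewrite [X in _ = X + _]big1 ?add0r; last by [].
under [RHS]eq_bigr do rewrite big_ord_recl add0r.
rewrite exchange_big coef_sum; apply: eq_bigr => y _ /=.
rewrite coef_sum.
rewrite (big_ord_widen N (fun x => (zsum 'X N x.+1 * zsum 'X N y.+1)`_m));
  last exact: ltnW.
rewrite big_mkcond; apply: eq_bigr => x _ /=.
by rewrite coef_zsumM /bump !add1n ltnS.
Qed.

(** * Comparison of the coefficients of [t^2] modulo [q^(N+1)] *)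

Lemma zsum_morph (R S : comNzRingType) (f : {rmorphism R -> S}) (q : R) N x :
  f (zsum q N x) = zsum (f q) N x.
Proof.
rewrite /zsum rmorph_sum; apply: eq_bigr => r _.
by rewrite rmorphM !rmorphXn rmorphN1.
Qed.

Lemma cong_coef (S : comNzRingType) (q : S) e (p r : {poly S}) i :
  cong q%:P e p r -> cong q e p`_i r`_i.
Proof. by case=> u ->; exists u`_i; rewrite coefD -rmorphXn coefCM. Qed.

Lemma cong_eq_coef (S : comNzRingType) e (p r : {poly S}) m :
  (m < e)%N -> cong 'X e p r -> p`_m = r`_m.
Proof. by move=> me [u ->]; rewrite coefD coefXnM me addr0. Qed.

Lemma theta_e2_mod N :
  cong ('X : {poly int}) N.+1
   ((\sum_(r < N.+1) (-1) ^+ T r * 'X^(T r)) *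
    (\sum_(y < N) \sum_(x < y) zsum 'X N x.+1 * zsum 'X N y.+1))
   (\sum_(n < N.+1) (cheb 'X n)`_2 * 'X^(T n)).
Proof.
(* In [{poly int}] the variable is [q]; in [{poly {poly int}}] the outer ['X] is [t] and [q] is
   ['X%:P]. [D] is the triple product at [t = 0]. *)
pose D : {poly int} := \prod_(i < N) ((1 - 'X ^+ i.+1) * (1 + 'X ^+ i.+1 ^+ 2)).
pose E : {poly {poly int}} := \prod_(i < N) (1 + 'X * (zsum 'X N i.+1)%:P).
rewrite -(coef2_prod_linear (fun i => zsum 'X N i.+1)) -/E.
apply: (@cong_trans _ _ _ _ (D * E`_2)).
  apply: congM; last exact: cong_refl.
  have := triple_product_mod 'X (0 : {poly int}) N.
  under eq_bigr do rewrite mul0r addr0.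
  under [X in cong _ _ _ X]eq_bigr do rewrite cheb_at0.
  exact: cong_sym.
(* As [D] is constant in [t], it can be moved inside the coefficient of [t^2]. *)
rewrite -coefCM.
have -> : \sum_(n < N.+1) (cheb 'X n)`_2 * 'X^(T n) =
    (\sum_(n < N.+1) cheb 'X n * 'X%:P ^+ T n)`_2 :> {poly int}.
  by rewrite coef_sum; apply: eq_bigr => n _; rewrite -rmorphXn coefMC.
apply: cong_coef; apply: cong_trans (triple_product_mod _ _ _).
rewrite /D rmorph_prod -big_split; apply: cong_prod => i _ /=.
rewrite rmorphM rmorphB rmorphD rmorph1 !rmorphXn -mulrA.
apply: congM; first exact: cong_refl.
(* The factor [1 + q^(2x)] of [D] clears the denominator of [z_x], turning [1 + t z_x] into
   [1 + q^(2x) + t q^x]. *)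
rewrite mulrDr mulr1; apply: congD; first exact: cong_refl.
rewrite mulrCA; apply: congM; first exact: cong_refl.
by rewrite zsum_morph; exact: zsum_mod.
Qed.

(** * Extraction of the coefficient of [q^n] *)

Lemma T_inj : injective T.
Proof.
have lt i j : (i < j)%N -> (T i < T j)%N.
  move=> ij; rewrite -(subnKC ij); elim: (j - i.+1)%N => [|k IH].
    by rewrite addn0 TS; lia.
  by rewrite addnS TS; lia.
by move=> i j Tij; case: (ltngtP i j) => // /lt; rewrite Tij ltnn.
Qed.

Lemma coef_signM (p : {poly int}) k m : ((-1) ^+ k * p)`_m = (-1) ^+ k * p`_m.
Proof. by rewrite -coefCM polyC_exp polyCN polyC1. Qed.

Lemma sum_a_ord (n : nat) :
  \sum_(r \in [set: nat]) (-1) ^+ T r * a (n%:Z - (T r)%:Z)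
  = \sum_(r < n.+1) (-1) ^+ T r * a (n%:Z - (T r)%:Z).
Proof.
rewrite (fsbig_ord _ n.+1 (fun r => (-1) ^+ T r * a (n%:Z - (T r)%:Z))).
apply/esym/fsbig_widen => // r [_ /negP]; rewrite -leqNgt /= => nr.
rewrite a_le0 ?mulr0 // subr_le0 lez_nat.
by apply: leq_trans (leq_T r); exact: ltnW.
Qed.

Lemma sum_a_cheb (n : nat) :
  \sum_(r \in [set: nat]) (-1) ^+ T r * a (n%:Z - (T r)%:Z)
  = \sum_(r < n.+1) ((cheb 'X r)`_2 * 'X^(T r) : {poly int})`_n.
Proof.
rewrite sum_a_ord -coef_sum -(cong_eq_coef (ltnSn n) (theta_e2_mod n)).
rewrite mulr_suml coef_sum; apply: eq_bigr => r _.
(* When [n < T r] the coefficient is 0, in agreement with [a] being 0 at negative arguments. *)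
rewrite -mulrA coef_signM coefXnM; case: ltnP => h.
  by rewrite a_le0 // subr_le0 lez_nat ltnW.
by rewrite coef_zsum_a ?leq_subr // subzn.
Qed.

Theorem corollary1p5 (n : nat) (n_gt0 : (0 < n)%N) :
  (forall k : nat, (1 <= k)%N -> n = T k.+1 ->
     \sum_(r \in [set: nat]) (-1) ^+ T r * a (n%:Z - (T r)%:Z)
       = (-1) ^+ T k.-1 * (T (uphalf k))%:Z)
  /\
  ((forall k : nat, (1 <= k)%N -> n <> T k.+1) ->
     \sum_(r \in [set: nat]) (-1) ^+ T r * a (n%:Z - (T r)%:Z) = 0).
Proof.
have coefn r : ((cheb 'X r.+2)`_2 * 'X^(T r.+2) : {poly int})`_n =
    (-1) ^+ T r * (T (uphalf r.+1))%:Z * (n == T r.+2)%:R.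
  rewrite coef2_cheb -[in LHS]mulrA coef_signM -polyC_natr coefCM coefXn natz.
  by rewrite mulrA.
rewrite sum_a_cheb; split=> [[|k] // _ nT|noT].
  (* Here [k] is one less than in the statement, so the surviving index is [k.+2]. The others drop
     out by injectivity of [T], or for [r < 2] because [cheb] has degree below 2. *)
  have lt : (k.+2 < n.+1)%N by rewrite ltnS nT leq_T.
  rewrite (bigD1 (Ordinal lt)) //= coefn -nT eqxx mulr1 big1 ?addr0 //.
  move=> [r ltr] /=; rewrite -val_eqE /= => rk.
  case: r ltr rk => [|[|r]] _ rk; try by rewrite coef2_cheb_lt2 // mul0r coef0.
  by rewrite coefn nT (inj_eq T_inj) eq_sym (negbTE rk) mulr0.
apply: big1 => -[[|[|r]] ltr] _; try by rewrite coef2_cheb_lt2 // mul0r coef0.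
rewrite [LHS]coefn; case: eqP => [nT|_]; last by rewrite mulr0.
by case: (noT r.+1).
Qed.
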